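(* Consider a $\sqrt{n}\times\sqrt{n}$ torus grid of $n$ servers and a library of $K=n^{1-\epsilon}$ files, for some constant $0<\epsilon<1$, with the Uniform popularity distribution $p_j=1/K$. Each server independently caches $M=\Theta(1)$ files, drawn independently from the popularity distribution with replacement. Then $n$ requests arrive sequentially; each request's origin server is chosen uniformly at random among the $n$ servers and its requested file is drawn from the popularity distribution. Under the Nearest Replica Strategy (Strategy I), the maximum load satisfies $L=\Theta(\log n)$ with high probability.
   Context: Strategy I (Nearest Replica Strategy): each request is assigned to the nearest server, in graph shortest-path distance on the torus, that has cached the requested file; ties are broken randomly. Letting $T_i$ be the number of requests assigned to server $i$ after all $n$ requests are assigned, the maximum load is $L=\max_{1\le i\le n}T_i$. ''With high probability'' means with probability $1-1/n^c$ for some constant $c>0$. *)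

(* Defs.v *)
From HB Require Import structures.
From mathcomp Require Import all_boot all_order all_algebra.
From mathcomp Require Import all_classical all_reals all_analysis.

Set Implicit Arguments.
Unset Strict Implicit.
Unset Printing Implicit Defensive.

Import Order.TTheory GRing.Theory Num.Theory.
Local Open Scope ring_scope.

(* Number of edges of a shortest [e]-path from [x] to [y]; a shortest path
   visits no vertex twice, so lengths below [#|T|] suffice, and the value is
   [#|T|] exactly when [y] is not reachable from [x]. *)
Definition graph_dist (T : finType) (e : rel T) (x y : T) : nat :=
  find (fun k => [exists p : k.-tuple T, path e x p && (last x p == y)])
       (iota 0 #|T|).

Lemma graph_dist_le (T : finType) (e : rel T) (x : T) (p : seq T) :
  path e x p -> (graph_dist e x (last x p) <= size p)%N.
Proof.
move=> ep; rewrite /graph_dist; set P := (X in find X _).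
have Pp : P (size p).
  by apply/existsP; exists (in_tuple p); rewrite /= ep eqxx.
have [lt_pT|le_Tp] := ltnP (size p) #|T|.
  rewrite leqNgt; apply/negP => lt_pf.
  by have := before_find 0%N lt_pf; rewrite nth_iota // add0n Pp.
by apply: leq_trans le_Tp; apply: leq_trans (find_size _ _) _; rewrite size_iota.
Qed.

Lemma graph_dist_path (T : finType) (e : rel T) (x y : T) :
  connect e x y ->
  exists p, [/\ path e x p, last x p = y & size p = graph_dist e x y].
Proof.
case/connectP => p0 /shortenP[p ep up _] ->.
rewrite /graph_dist; set P := (X in find X _).
have lt_pT : (size p < #|T|)%N.
  by rewrite -[(size p).+1]/(size (x :: p)) -(card_uniqP up) max_card.
have hP : has P (iota 0 #|T|).
  apply/hasP; exists (size p); first by rewrite mem_iota.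
  by apply/existsP; exists (in_tuple p); rewrite /= ep eqxx.
have := nth_find 0%N hP; rewrite nth_iota; last first.
  by move: hP; rewrite has_find size_iota.
rewrite add0n => /existsP[q /andP[eq_ /eqP lq]].
by exists q; rewrite lq size_tuple.
Qed.

Definition server (m : nat) : finType := ('I_m * 'I_m)%type.

Definition torus_adj (m : nat) : rel (server m) := fun u v =>
  ((u.1 == v.1) && ((v.2 == ordS u.2) || (u.2 == ordS v.2))) ||
  ((u.2 == v.2) && ((v.1 == ordS u.1) || (u.1 == ordS v.1))).

Definition torus_dist (m : nat) (u v : server m) : nat :=
  graph_dist (@torus_adj m) u v.

Section Model.
Variables (R : realType) (m K M : nat).

Let n := (m ^ 2)%N.

Definition placement : finType := {ffun server m -> {ffun 'I_M -> 'I_K}}.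

Definition requests : finType := {ffun 'I_n -> server m * 'I_K}.

(* [None]: the request is not served, which happens only when the requested
   file is cached nowhere. *)
Definition assignment : finType := {ffun 'I_n -> option (server m)}.

Definition outcome : finType := (placement * requests * assignment)%type.

Definition caches (c : placement) (s : server m) (j : 'I_K) : bool :=
  [exists i : 'I_M, c s i == j].

Definition nearest_replicas (c : placement) (u : server m) (j : 'I_K) :
    {set server m} :=
  [set s | caches c s j &&
     [forall s', caches c s' j ==> (torus_dist u s <= torus_dist u s')%N]].

Definition uniform_popularity : 'I_K -> R := fun=> K%:R^-1.

Definition placement_pmf (p : 'I_K -> R) (c : placement) : R :=
  \prod_(s : server m) \prod_(i : 'I_M) p (c s i).

Definition requests_pmf (p : 'I_K -> R) (r : requests) : R :=
  \prod_(t : 'I_n) (n%:R^-1 * p (r t).2).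

Definition nearest_replica_kernel (c : placement) (u : server m) (j : 'I_K)
    (a : option (server m)) : R :=
  let N := nearest_replicas c u j in
  if a is Some s then (if s \in N then #|N|%:R^-1 else 0)
  else (#|N| == 0%N)%:R.

Definition assignment_pmf (c : placement) (r : requests) (a : assignment) : R :=
  \prod_(t : 'I_n) nearest_replica_kernel c (r t).1 (r t).2 (a t).

Definition strategy1_pmf (p : 'I_K -> R) (w : outcome) : R :=
  let: (c, r, a) := w in
  placement_pmf p c * requests_pmf p r * assignment_pmf c r a.

Definition strategy1_prob (p : 'I_K -> R) (E : pred outcome) : R :=
  \sum_(w | E w) strategy1_pmf p w.

Definition load (w : outcome) (s : server m) : nat :=
  #|[set t : 'I_n | w.2 t == Some s]|.

Definition max_load (w : outcome) : nat := \max_(s : server m) load w s.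

Lemma strategy1_prob_total : (0 < m)%N -> (0 < K)%N ->
  strategy1_prob uniform_popularity predT = 1.
Proof.
move=> m0 K0.
have K1 : \sum_(j : 'I_K) uniform_popularity j = 1 :> R.
  rewrite /uniform_popularity sumr_const card_ord -[LHS]mulr_natr mulVf //.
  by rewrite pnatr_eq0 -lt0n.
have kern1 c u j : \sum_a nearest_replica_kernel c u j a = 1.
  rewrite /nearest_replica_kernel; set N := nearest_replicas c u j.
  rewrite (bigD1 None) //=.
  rewrite (reindex_omap Some id) /=; last by case.
  under eq_bigl do rewrite eqxx.
  rewrite -big_mkcond /= sumr_const -[X in _ + X]mulr_natr.
  have [->|N0] := eqVneq #|N| 0%N; first by rewrite mulr0 addr0.
  by rewrite add0r mulVf ?pnatr_eq0.
rewrite /strategy1_prob.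
transitivity (\sum_(cr : placement * requests) \sum_(a : assignment)
    strategy1_pmf uniform_popularity (cr, a)).
  by rewrite pair_bigA; apply: eq_bigr => -[].
transitivity (\sum_(cr : placement * requests)
    placement_pmf uniform_popularity cr.1 *
    requests_pmf uniform_popularity cr.2).
  apply: eq_bigr => -[c r] _; rewrite -mulr_sumr.
  rewrite [X in _ * X](_ : _ = 1) ?mulr1 //.
  rewrite /assignment_pmf.
  rewrite -(bigA_distr_bigA (fun t a =>
    nearest_replica_kernel c (r t).1 (r t).2 a)).
  by apply: big1 => t _.
rewrite -(pair_bigA _ (fun c r => placement_pmf uniform_popularity c *
    requests_pmf uniform_popularity r)) /=.
under eq_bigr do rewrite -mulr_sumr.
rewrite -mulr_suml.
have -> : \sum_(c : placement) placement_pmf uniform_popularity c = 1.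
  rewrite /placement_pmf.
  rewrite -(bigA_distr_bigA (fun (s : server m) (f : {ffun 'I_M -> 'I_K}) =>
     \prod_i uniform_popularity (f i))).
  apply: big1 => s _.
  by rewrite -(bigA_distr_bigA (fun (i : 'I_M) j => uniform_popularity j)) big1.
rewrite mul1r /requests_pmf.
rewrite -(bigA_distr_bigA (fun (t : 'I_n) (x : server m * 'I_K) =>
  n%:R^-1 * uniform_popularity x.2)).
apply: big1 => t _.
rewrite -(pair_bigA _ (fun (u : server m) j => n%:R^-1 * uniform_popularity j)) /=.
under eq_bigr do rewrite -mulr_sumr K1 mulr1.
rewrite sumr_const card_prod !card_ord mulnn -[LHS]mulr_natr mulVf //.
by rewrite pnatr_eq0 -lt0n expn_gt0 m0.
Qed.

End Model.

(* Main.v *)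
Require Import Defs.
From HB Require Import structures.
From mathcomp Require Import all_boot all_order all_algebra.
From mathcomp Require Import all_classical all_reals all_analysis.
From mathcomp Require Import zify ring lra.
Set Implicit Arguments.
Unset Strict Implicit.
Unset Printing Implicit Defensive.
Import Order.TTheory GRing.Theory Num.Theory numFieldNormedType.Exports.
Local Open Scope ring_scope.

(* Given the placement, the load of a server [s] is binomial with [n] trials and
   success probability [p_s], the total size of the Voronoi cells of [s] for the
   files it caches divided by [n * K]; so by Chernoff bounds everything reduces to
   [n * p_s = O(log n)] for all [s] and [n * p_s = Omega(log n)] for some [s].

   Upper bound: a square of area at least [4 * K * log n] misses a given file with
   probability at most [n^-4], so with high probability every request is served
   within distance [O(sqrt (K * log n))] and all cells have size [O(K * log n)].

   Lower bound: fix one file and cut the torus into disjoint boxes of side [12 * g],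
   where [g^2] is about [eta * K * log n].  The events "exactly one server of the
   box caches the file, and it lies in the middle third of the box" are independent
   over the boxes, and each has probability at least about [n^(-eps/4)] while there
   are about [n^eps / log n] boxes, so with high probability some event occurs.
   The server found there is the nearest replica for the [g^2] origins next to it. *)

(** * Geometry of the torus *)

Lemma torus_adj_sym (m : nat) : symmetric (@torus_adj m).
Proof.
move=> u v; rewrite /torus_adj (eq_sym u.1 v.1) (eq_sym u.2 v.2).
by congr (_ && _ || _ && _); apply: orbC.
Qed.

(** A step changes the coordinate by -1, 0 or 1 modulo [m]; adding 1 on both sides encodes this as a
    natural shift [e] and avoids subtraction. *)
Lemma torus_adj_shift1 (m : nat) (u v : server m) : torus_adj u v ->
  exists2 e : nat, (e <= 2)%N & v.1 + 1 = u.1 + e %[mod m].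
Proof.
case/orP => /andP[/eqP uv].
  by move=> _; exists 1%N; rewrite // uv.
case/orP => /eqP ->; [exists 2 | exists 0%N] => //=; rewrite modnDml.
  by rewrite addSnnS.
by rewrite addn1 addn0.
Qed.

Lemma torus_adj_shift2 (m : nat) (u v : server m) : torus_adj u v ->
  exists2 e : nat, (e <= 2)%N & v.2 + 1 = u.2 + e %[mod m].
Proof.
move=> uv; apply: (@torus_adj_shift1 m (u.2, u.1) (v.2, v.1)).
by move: uv; rewrite /torus_adj /= orbC.
Qed.

(** The shifts of the steps add up, each step also adding 1 to the offset on the left. *)
Lemma torus_path_shift (m : nat) (f : server m -> 'I_m)
    (fS : forall u v, torus_adj u v ->
       exists2 e : nat, (e <= 2)%N & f v + 1 = f u + e %[mod m])
    (u : server m) (p : seq (server m)) : path (@torus_adj m) u p ->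
  exists2 a : nat, (a <= 2 * size p)%N &
    f (last u p) + size p = f u + a %[mod m].
Proof.
elim: p u => [|w p IHp] u /=; first by move=> _; exists 0%N.
case/andP => /fS[e e2 we] /IHp[a a2 wa]; exists (a + e)%N.
  by rewrite mulnS addnC leq_add.
rewrite -addn1 addnA -modnDml wa modnDml addnAC -modnDml we modnDml.
by congr (_ %% _)%N; lia.
Qed.

(** The walk approaches [v] one coordinate at a time and never wraps around. Each sum of two
    truncated subtractions is an absolute difference. *)
Lemma torus_path_le_l1 (m : nat) (u v : server m) :
  exists p, [/\ path (@torus_adj m) u p, last u p = v &
    size p = (u.1 - v.1 + (v.1 - u.1) + (u.2 - v.2) + (v.2 - u.2))%N].
Proof.
have [k kd] : exists k : nat,
    k = (u.1 - v.1 + (v.1 - u.1) + (u.2 - v.2) + (v.2 - u.2))%N by eexists.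
rewrite -kd; elim: k u kd => [|k IHk] u kd.
  exists [::]; split => //=.
  case: u v kd => [u1 u2] [v1 v2] /= h.
  by congr (_, _); apply: val_inj => /=; lia.
suff [w uw dw] : exists2 w : server m, torus_adj u w &
    k = (w.1 - v.1 + (v.1 - w.1) + (w.2 - v.2) + (v.2 - w.2))%N.
  have [p [wp pv sp]] := IHk w dw.
  by exists (w :: p); split; rewrite //= ?uw // sp.
case: u v kd {IHk} => [u1 u2] [v1 v2] /= h.
have ? := ltn_ord u1; have ? := ltn_ord u2.
have ? := ltn_ord v1; have ? := ltn_ord v2.
have [h1|h1|/val_inj h1] := ltngtP u1 v1.
- have h2 : (u1.+1 < m)%N by lia.
  exists (Ordinal h2, u2); last by rewrite /=; lia.
  apply/orP; right; rewrite /= eqxx; apply/orP; left.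
  by apply/eqP/val_inj; rewrite /= modn_small.
- have h2 : (u1.-1 < m)%N by lia.
  exists (Ordinal h2, u2); last by rewrite /=; lia.
  apply/orP; right; rewrite /= eqxx; apply/orP; right.
  by apply/eqP/val_inj; rewrite /= prednK ?modn_small //; lia.
- have [h2|h2|h2] := ltngtP u2 v2; last by rewrite h1 in h; lia.
  + have h3 : (u2.+1 < m)%N by lia.
    exists (u1, Ordinal h3); last by rewrite /=; lia.
    apply/orP; left; rewrite /= eqxx; apply/orP; left.
    by apply/eqP/val_inj; rewrite /= modn_small.
  + have h3 : (u2.-1 < m)%N by lia.
    exists (u1, Ordinal h3); last by rewrite /=; lia.
    apply/orP; left; rewrite /= eqxx; apply/orP; right.
    by apply/eqP/val_inj; rewrite /= prednK ?modn_small //; lia.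
Qed.

Lemma torus_dist_le_l1 (m : nat) (u v : server m) :
  (torus_dist u v <=
     u.1 - v.1 + (v.1 - u.1) + (u.2 - v.2) + (v.2 - u.2))%N.
Proof.
have [p [up <- <-]] := torus_path_le_l1 u v; exact: graph_dist_le.
Qed.

Lemma torus_dist_path (m : nat) (u v : server m) :
  exists p, [/\ path (@torus_adj m) u p, last u p = v &
    size p = torus_dist u v].
Proof.
apply: graph_dist_path; have [p [up <- _]] := torus_path_le_l1 u v.
by apply/connectP; exists p.
Qed.

(** Adjacency is symmetric, so a reversed shortest path bounds the distance in the other
    direction. *)
Lemma torus_distC (m : nat) (u v : server m) : torus_dist u v = torus_dist v u.
Proof.
suff le_d (x y : server m) : (torus_dist y x <= torus_dist x y)%N.
  by apply/eqP; rewrite eqn_leq !le_d.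
have [p [xp <- <-]] := torus_dist_path x y.
have /graph_dist_le : path (@torus_adj m) (last x p) (rev (belast x p)).
  by rewrite rev_path; under eq_path do rewrite torus_adj_sym.
rewrite size_rev size_belast; congr (graph_dist _ _ _ <= _)%N.
by case: p {xp} => //= y0 p; rewrite rev_cons last_rcons.
Qed.

Lemma torus_dist_triangle (m : nat) (u v w : server m) :
  (torus_dist u w <= torus_dist u v + torus_dist v w)%N.
Proof.
have [p [up <- <-]] := torus_dist_path u v.
have [q [vq <- <-]] := torus_dist_path (last u p) w.
by rewrite -size_cat -last_cat; apply: graph_dist_le; rewrite cat_path up.
Qed.

(** A ball is confined to a window of coordinates within [k] of its centre modulo [m]; the window is
    moved by [k] to stay in [nat]. *)
Lemma torus_dist_shift (m : nat) (u v : server m) (k : nat) :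
  (torus_dist u v <= k)%N ->
  (exists2 a : nat, (a <= 2 * k)%N & v.1 + k = u.1 + a %[mod m]) /\
  (exists2 a : nat, (a <= 2 * k)%N & v.2 + k = u.2 + a %[mod m]).
Proof.
have [p [up <- <-]] := torus_dist_path u v => pk.
have widen (f : server m -> 'I_m) : (exists2 a : nat, (a <= 2 * size p)%N &
    f (last u p) + size p = f u + a %[mod m]) ->
    exists2 a : nat, (a <= 2 * k)%N & f (last u p) + k = f u + a %[mod m].
  (* A path shorter than [k] is padded by adding the missing length to both sides. *)
  case=> a ap e; exists (a + (k - size p))%N.
    by move: ap pk; clear; lia.
  by rewrite [in RHS]addnA -[in RHS]modnDml -e modnDml -addnA subnKC.
split; apply: widen; apply: torus_path_shift up.
- exact: torus_adj_shift1.
- exact: torus_adj_shift2.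
Qed.

Lemma card_torus_ball (m : nat) (s : server m) (k : nat) :
  (#|[set u : server m | torus_dist u s <= k]| <= (2 * k).+1 ^ 2)%N.
Proof.
have m0 : (0 < m)%N by apply: leq_trans (ltn_ord s.1).
(* The term [k * m.-1] stands for [-k] modulo [m], so the image of [G] contains every server with
   both coordinates within [k] of those of [s]. *)
pose G (a : 'I_((2 * k).+1) * 'I_((2 * k).+1)) : server m :=
  (Ordinal (ltn_pmod (s.1 + a.1 + k * m.-1) m0),
   Ordinal (ltn_pmod (s.2 + a.2 + k * m.-1) m0)).
apply: (@leq_trans #|G @: [set: _]|); last first.
  by apply: leq_trans (leq_imset_card _ _) _; rewrite cardsT card_prod card_ord.
apply: subset_leq_card; apply/fintype.subsetP => u; rewrite inE torus_distC.
have back (x y : 'I_m) a : x + k = y + a %[mod m] ->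
    x = ((y + a + k * m.-1) %% m)%N :> nat.
  move=> e; rewrite -modnDml -e modnDml -addnA -mulnS prednK // addnC modnMDl.
  by rewrite modn_small.
case/torus_dist_shift => -[a ak /back ea] [b bk /back eb].
rewrite -ltnS in ak; rewrite -ltnS in bk.
apply/imsetP; exists (Ordinal ak, Ordinal bk); rewrite ?inE //.
by case: u ea eb => u1 u2 /= ea eb; congr (_, _); apply: val_inj.
Qed.

(** * Squares and boxes in the torus *)

Definition torus_square (m x y len : nat) : {set server m} :=
  [set v : server m | (x <= v.1 < x + len) && (y <= v.2 < y + len)]%N.

Lemma card_ord_interval (m x len : nat) : (x + len <= m)%N ->
  #|[set i : 'I_m | x <= i < x + len]%N| = len.
Proof.
move=> xm; have lt_xm (a : 'I_len) : (x + a < m)%N.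
  by have := ltn_ord a; lia.
rewrite -[RHS](card_ord len) -(card_imset _ (f := fun a => Ordinal (lt_xm a))).
  apply: eq_card => i; rewrite inE; apply/idP/imsetP => [|[a _ ->]] /=.
    move=> h; have h2 : (i - x < len)%N by lia.
    by exists (Ordinal h2) => //; apply: val_inj => /=; lia.
  by have := ltn_ord a; lia.
by move=> a b [] /addnI /val_inj.
Qed.

Lemma card_torus_square (m x y len : nat) :
  (x + len <= m)%N -> (y + len <= m)%N -> #|torus_square m x y len| = (len ^ 2)%N.
Proof.
move=> xm ym; transitivity #|finset.setX [set i : 'I_m | x <= i < x + len]%N
    [set i : 'I_m | y <= i < y + len]%N|; last by rewrite cardsX !card_ord_interval.
by apply: eq_card => -[v1 v2]; rewrite finset.in_setX !inE.
Qed.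

Lemma torus_square_dist (m x y len : nat) (u v : server m) :
  u \in torus_square m x y len -> v \in torus_square m x y len ->
  (torus_dist u v <= 2 * len)%N.
Proof.
rewrite !inE => hu hv; apply: leq_trans (torus_dist_le_l1 _ _) _; lia.
Qed.

(* A square containing [u], pushed back inside the fundamental domain so that it
   does not wrap around. *)
Definition torus_square_around (m : nat) (u : server m) (len : nat) :=
  torus_square m (minn u.1 (m - len)) (minn u.2 (m - len)) len.

Lemma mem_torus_square_around (m : nat) (u : server m) (len : nat) :
  (0 < len <= m)%N -> u \in torus_square_around u len.
Proof.
by move=> lenm; rewrite !inE; have := ltn_ord u.1; have := ltn_ord u.2; lia.
Qed.

Lemma card_torus_square_around (m : nat) (u : server m) (len : nat) :
  (len <= m)%N -> #|torus_square_around u len| = (len ^ 2)%N.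
Proof. by move=> lenm; rewrite card_torus_square //; lia. Qed.

Definition torus_box (m l i j : nat) := torus_square m (i * l) (j * l) l.

(* The middle third of a box of side [12 * g], so that the ball of radius [4 * g]
   around each of its points stays in the box. *)
Definition torus_box_core (m g i j : nat) :=
  torus_square m (i * (12 * g) + 4 * g) (j * (12 * g) + 4 * g) (4 * g).

Lemma torus_box_core_dist (m g i j : nat) (s v : server m) :
  (i < m %/ (12 * g))%N -> (j < m %/ (12 * g))%N ->
  s \in torus_box_core m g i j -> (torus_dist s v <= 4 * g)%N ->
  v \in torus_box m (12 * g) i j.
Proof.
move=> iq jq; rewrite !inE => /andP[s1 s2].
(* A move of [4 * g] from the core cannot leave the box, which ends at or before [m]; the congruence
   relates numbers below [m] and becomes an equality. *)
have coord (x y : 'I_m) a k : (k < m %/ (12 * g))%N ->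
    (k * (12 * g) + 4 * g <= x < k * (12 * g) + 4 * g + 4 * g)%N ->
    (a <= 2 * (4 * g))%N -> y + 4 * g = x + a %[mod m] ->
    (k * (12 * g) <= y < k * (12 * g) + 12 * g)%N.
  move=> kq xk ak; have km : (k.+1 * (12 * g) <= m)%N.
    by apply: leq_trans (leq_divM m (12 * g)); rewrite leq_mul2r kq orbT.
  rewrite mulSn in km.
  have -> : (x + a = (x + a - 4 * g) + 4 * g)%N by lia.
  move/eqP; rewrite eqn_modDr modn_small // modn_small; last lia.
  by move/eqP => ->; lia.
case/torus_dist_shift => -[a ak ea] [b bk eb].
by rewrite (coord s.1 v.1 a i) ?(coord s.2 v.2 b j).
Qed.

Lemma torus_box_disjoint (m l i j i' j' : nat) (v : server m) :
  v \in torus_box m l i j -> v \in torus_box m l i' j' -> i = i' /\ j = j'.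
Proof.
have uniq_div (x k k' : nat) : (k * l <= x < k * l + l)%N ->
    (k' * l <= x < k' * l + l)%N -> k = k' by nia.
by rewrite !inE => /andP[h1 h2] /andP[h3 h4]; split;
  [apply: uniq_div h1 h3 | apply: uniq_div h2 h4].
Qed.

Lemma torus_box_core_sub (m g i j : nat) (s : server m) :
  s \in torus_box_core m g i j -> s \in torus_box m (12 * g) i j.
Proof. by rewrite !inE => /andP[/andP[h1 h2] /andP[h3 h4]]; lia. Qed.

Lemma torus_box_fits (m l i : nat) : (i < m %/ l)%N -> (i * l + l <= m)%N.
Proof.
move=> il; apply: leq_trans (leq_divM m l).
by rewrite addnC -mulSn leq_mul2r il orbT.
Qed.

(** * Expectations under product measures *)

Definition product_expectation (R : realType) (T X : finType) (w : X -> R)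
    (f : {ffun T -> X} -> R) : R :=
  \sum_(c : {ffun T -> X}) (\prod_t w (c t)) * f c.

Lemma product_expectation_prod (R : realType) (T X : finType) (w : X -> R)
    (f : T -> X -> R) :
  product_expectation w (fun c : {ffun T -> X} => \prod_t f t (c t)) =
  \prod_t \sum_x w x * f t x.
Proof.
rewrite /product_expectation bigA_distr_bigA /=.
by apply: eq_bigr => c _; rewrite big_split.
Qed.

Lemma product_expectation1 (R : realType) (T X : finType) (w : X -> R) :
  \sum_x w x = 1 -> product_expectation w (fun _ : {ffun T -> X} => 1) = 1.
Proof.
move=> w1; rewrite /product_expectation.
under eq_bigr do rewrite mulr1.
by rewrite -(bigA_distr_bigA (fun _ x => w x)) big1.
Qed.

Lemma eq_product_expectation (R : realType) (T X : finType) (w : X -> R)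
    (f g : {ffun T -> X} -> R) : f =1 g ->
  product_expectation w f = product_expectation w g.
Proof. by move=> fg; apply: eq_bigr => c _; rewrite fg. Qed.

Lemma le_product_expectation (R : realType) (T X : finType) (w : X -> R)
    (f g : {ffun T -> X} -> R) : (forall x, 0 <= w x) ->
  (forall c, f c <= g c) -> product_expectation w f <= product_expectation w g.
Proof.
move=> w0 fg; apply: ler_sum => c _; apply: ler_wpM2l; last exact: fg.
exact: prodr_ge0.
Qed.

Lemma product_expectationD (R : realType) (T X : finType) (w : X -> R)
    (f g : {ffun T -> X} -> R) :
  product_expectation w (fun c => f c + g c) =
  product_expectation w f + product_expectation w g.
Proof.
by rewrite /product_expectation -big_split; apply: eq_bigr => c _; rewrite mulrDr.
Qed.

Lemma product_expectation_cst (R : realType) (T X : finType) (w : X -> R) (k : R) :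
  \sum_x w x = 1 -> product_expectation w (fun _ : {ffun T -> X} => k) = k.
Proof.
move=> w1; rewrite -[RHS]mul1r -[X in _ = X * _](product_expectation1 T w1).
by rewrite /product_expectation mulr_suml; apply: eq_bigr => c _; rewrite mulr1.
Qed.

Lemma product_expectation_sum (R : realType) (T X I : finType) (w : X -> R)
    (P : pred I) (f : I -> {ffun T -> X} -> R) :
  product_expectation w (fun c => \sum_(i | P i) f i c) =
  \sum_(i | P i) product_expectation w (f i).
Proof.
rewrite /product_expectation exchange_big /=.
by apply: eq_bigr => c _; rewrite mulr_sumr.
Qed.

Lemma product_expectation_compl (R : realType) (T X : finType) (w : X -> R)
    (f : {ffun T -> X} -> R) : \sum_x w x = 1 ->
  product_expectation w (fun c => 1 - f c) = 1 - product_expectation w f.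
Proof.
move=> w1; rewrite -[X in _ = X - _](product_expectation1 T w1).
rewrite /product_expectation -sumrB.
by apply: eq_bigr => c _; rewrite mulr1 mulrBr mulr1.
Qed.

(** Measurability with respect to the coordinates in [A]. *)
Definition depends_on (T X : finType) (Y : Type) (A : {set T})
    (f : {ffun T -> X} -> Y) : Prop :=
  forall c d : {ffun T -> X}, {in A, c =1 d} -> f c = f d.

(* On pairs of independent copies, exchanging the coordinates outside [A] is a
   measure preserving involution turning [f c * g d] into [f c * g c]. *)
Lemma product_expectation_indep (R : realType) (T X : finType) (w : X -> R)
    (A : {set T}) (f g : {ffun T -> X} -> R) : \sum_x w x = 1 ->
  depends_on A f -> depends_on (~: A) g ->
  product_expectation w (fun c => f c * g c) =
  product_expectation w f * product_expectation w g.
Proof.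
move=> w1 fA gA; pose mu (c : {ffun T -> X}) := \prod_t w (c t).
pose mix (c d : {ffun T -> X}) := [ffun t => if t \in A then c t else d t].
transitivity (\sum_(p : {ffun T -> X} * {ffun T -> X})
    (mu p.1 * mu p.2) * (f p.1 * g p.1)).
  rewrite -(pair_bigA _ (fun c d => mu c * mu d * (f c * g c))) /=.
  apply: eq_bigr => c _; rewrite -mulr_suml -mulr_sumr.
  have -> : \sum_d mu d = 1.
    rewrite -(product_expectation1 T w1); apply: eq_bigr => d _.
    by rewrite mulr1.
  by rewrite mulr1.
have invK : involutive (fun p : {ffun T -> X} * {ffun T -> X} =>
    (mix p.1 p.2, mix p.2 p.1)).
  by case=> c d; congr (_, _); apply/ffunP => t; rewrite /= !ffunE; case: (t \in A).
rewrite (reindex_inj (inv_inj invK)) /=.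
rewrite /product_expectation big_distrlr /= pair_bigA.
apply: eq_bigr => -[c d] _ /=.
have -> : f (mix c d) = f c by apply: fA => t tA; rewrite ffunE tA.
have -> : g (mix c d) = g d.
  by apply: gA => t; rewrite inE => /negbTE tA; rewrite ffunE tA.
have -> : mu (mix c d) * mu (mix d c) = mu c * mu d.
  rewrite /mu -!big_split; apply: eq_bigr => t _; rewrite /= !ffunE.
  by case: ifP => _ //; rewrite mulrC.
by rewrite mulrACA.
Qed.

(** Blocks are split off one at a time: by disjointness, the remaining factors depend only on
    coordinates outside [B i]. *)
Lemma product_expectation_blocks (R : realType) (T X I : finType) (w : X -> R)
    (B : I -> {set T}) (f : I -> {ffun T -> X} -> R) : \sum_x w x = 1 ->
  (forall i j t, t \in B i -> t \in B j -> i = j) ->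
  (forall i, depends_on (B i) (f i)) ->
  product_expectation w (fun c => \prod_i f i c) =
  \prod_i product_expectation w (f i).
Proof.
(* The enumeration has no duplicates, so the block split off does not recur among the remaining
   factors. *)
move=> w1 disjB fB; elim: (index_enum I) (index_enum_uniq I) => [_|i s IHs].
  under eq_product_expectation do rewrite big_nil.
  by rewrite big_nil product_expectation1.
case/andP => iNs us; rewrite big_cons -IHs //.
rewrite -(@product_expectation_indep _ _ _ w (B i)) //.
  by apply: eq_product_expectation => c; rewrite big_cons.
move=> c d cd; apply: eq_big_seq => j js; apply: fB => t tj; apply: cd.
rewrite inE; apply: contra iNs => ti.
by rewrite (disjB i j t).
Qed.

(** At most one point satisfies [P]; the probability of existence thus becomes a sum by
    linearity. *)
Lemma indicator_exists_sum (R : realType) (T : finType) (A : {pred T})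
    (P : pred T) : {in A &, forall x y, P x -> P y -> x = y} ->
  \sum_(x in A) (P x)%:R = ([exists x in A, P x])%:R :> R.
Proof.
move=> uniqP; case: existsP => [[x /andP[xA Px]]|noP].
  rewrite (bigD1 x) //= Px big1 ?addr0 // => y /andP[yA].
  by case Py: (P y) => // /eqP[]; apply: uniqP.
rewrite big1 // => x xA; case Px: (P x) => //.
by case: noP; exists x; rewrite xA.
Qed.

Lemma indicator_forall_prod (R : realType) (T : finType) (P Q : pred T) :
  [forall (x | P x), Q x]%:R = \prod_(x | P x) (Q x)%:R :> R.
Proof.
case: (boolP [forall (x | P x), Q x]) => [/forallP allQ|].
  by rewrite big1 // => x Px; have := allQ x; rewrite Px /= => ->.
rewrite negb_forall => /existsP[x]; rewrite negb_imply => /andP[Px /negbTE Qx].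
by rewrite (bigD1 x) //= Qx mul0r.
Qed.

(** * Random placements *)

(** The law of one server's cache; a placement is an independent family of such caches. *)
Definition cache_weight (R : realType) (K M : nat) (f : {ffun 'I_M -> 'I_K}) : R :=
  \prod_i uniform_popularity R (f i).

Lemma cache_weight_ge0 (R : realType) (K M : nat) (f : {ffun 'I_M -> 'I_K}) :
  0 <= cache_weight R f.
Proof. by apply: prodr_ge0 => i _; rewrite invr_ge0 ler0n. Qed.

Lemma sum_uniform_popularity (R : realType) (K : nat) : (0 < K)%N ->
  \sum_j uniform_popularity R (K := K) j = 1.
Proof.
move=> K0; rewrite /uniform_popularity sumr_const card_ord -[LHS]mulr_natr.
by rewrite mulVf // pnatr_eq0 -lt0n.
Qed.

Lemma sum_cache_weight (R : realType) (K M : nat) : (0 < K)%N ->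
  \sum_(f : {ffun 'I_M -> 'I_K}) cache_weight R f = 1.
Proof.
move=> K0; rewrite -(bigA_distr_bigA (fun (i : 'I_M) j => uniform_popularity R j)).
by rewrite big1 // => i _; rewrite sum_uniform_popularity.
Qed.

Lemma cache_weight_avoid (R : realType) (K M : nat) (j : 'I_K) :
  \sum_(f : {ffun 'I_M -> 'I_K}) cache_weight R f * (~~ [exists i, f i == j])%:R =
  (1 - K%:R^-1) ^+ M.
Proof.
have K0 : (0 < K)%N by apply: leq_trans (ltn_ord j).
transitivity (\prod_(i : 'I_M) \sum_(k : 'I_K) uniform_popularity R k * (k != j)%:R).
  rewrite bigA_distr_bigA /=; apply: eq_bigr => f _; rewrite big_split /=.
  by congr (_ * _); rewrite negb_exists -(indicator_forall_prod R predT).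
rewrite (eq_bigr (fun=> 1 - K%:R^-1)) ?prodr_const ?card_ord // => i _.
rewrite -[X in X - _](sum_uniform_popularity R K0) (bigD1 j) //= eqxx mulr0 add0r.
rewrite [X in _ = X - _](bigD1 j) //= /uniform_popularity addrAC subrr add0r.
by apply: eq_bigr => k ->; rewrite mulr1.
Qed.

Definition placement_expectation (R : realType) (m K M : nat)
    (f : placement m K M -> R) : R :=
  product_expectation (@cache_weight R K M) f.

(** The probability that a given server misses a given file in all its [M] draws. *)
Definition avoid_prob (R : realType) (K M : nat) : R := (1 - K%:R^-1) ^+ M.

Lemma avoid_prob_itv (R : realType) (K M : nat) : (0 < K)%N ->
  0 <= avoid_prob R K M <= 1.
Proof.
move=> K0; have K1 : 0 <= (1 - K%:R^-1 : R) <= 1.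
  by rewrite subr_ge0 gerBl invr_ge0 ler0n invf_le1 ?ltr0n // ler1n K0.
by case/andP: K1 => ? ?; rewrite exprn_ge0 // exprn_ile1.
Qed.

Lemma placement_avoid (R : realType) (m K M : nat) (S : {set server m}) (j : 'I_K) :
  placement_expectation (fun c : placement m K M =>
    ([forall s in S, ~~ caches c s j])%:R) = avoid_prob R K M ^+ #|S|.
Proof.
have K0 : (0 < K)%N by apply: leq_trans (ltn_ord j).
(* One factor per server, equal to 1 outside [S], so that independence over the servers applies. *)
pose h (s : server m) (f : {ffun 'I_M -> 'I_K}) : R :=
  if s \in S then (~~ [exists i, f i == j])%:R else 1.
transitivity (placement_expectation (fun c : placement m K M => \prod_s h s (c s))).
  apply: eq_product_expectation => c; rewrite /h -big_mkcond /=.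
  exact: indicator_forall_prod.
rewrite /placement_expectation product_expectation_prod -prodr_const.
rewrite [RHS]big_mkcond /=; apply: eq_bigr => s _; rewrite /h; case: ifP => _.
  exact: cache_weight_avoid.
by under eq_bigr do rewrite mulr1; apply: sum_cache_weight.
Qed.

(** Naming the server [s] makes the event a conjunction of conditions on single servers, hence of
    product form. *)
Definition sole_replica (m K M : nat) (c : placement m K M) (S : {set server m})
    (j : 'I_K) (s : server m) : bool :=
  caches c s j && [forall s' in S :\ s, ~~ caches c s' j].

Lemma sole_replica_uniq (m K M : nat) (c : placement m K M) (S : {set server m})
    (j : 'I_K) (s s' : server m) : s \in S -> s' \in S ->
  sole_replica c S j s -> sole_replica c S j s' -> s = s'.
Proof.
move=> sS s'S /andP[cs /forallP alls] /andP[cs' _]; apply: contraTeq cs' => ns.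
by have /implyP := alls s'; rewrite !inE eq_sym ns s'S; apply.
Qed.

Lemma sole_replica_depends (m K M : nat) (S : {set server m}) (j : 'I_K)
    (s : server m) : s \in S ->
  depends_on S (fun c : placement m K M => sole_replica c S j s).
Proof.
move=> sS c d cd; rewrite /sole_replica /caches cd //; congr (_ && _).
apply: eq_forallb => s'; case: (boolP (s' \in S :\ s)) => //=.
by rewrite !inE => /andP[_ s'S]; rewrite cd.
Qed.

(** With [q] the avoidance probability, independence gives [(1 - q) * q ^ (#|S| - 1)]. As [0 < M],
    [1 - q] is at least [1 / K], and a further factor [q <= 1] may be inserted. *)
Lemma placement_sole_replica (R : realType) (m K M : nat) (S : {set server m})
    (j : 'I_K) (s : server m) : (0 < M)%N -> s \in S ->
  K%:R^-1 * avoid_prob R K M ^+ #|S| <=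
  placement_expectation (fun c : placement m K M => (sole_replica c S j s)%:R).
Proof.
move=> M0 sS; have K0 : (0 < K)%N by apply: leq_trans (ltn_ord j).
have /andP[q0 q1] := avoid_prob_itv R M K0.
pose h (t : server m) (f : {ffun 'I_M -> 'I_K}) : R :=
  if t == s then [exists i, f i == j]%:R else
  if t \in S then (~~ [exists i, f i == j])%:R else 1.
have -> : placement_expectation (fun c : placement m K M =>
    (sole_replica c S j s)%:R) =
    placement_expectation (fun c : placement m K M => \prod_t h t (c t)) :> R.
  apply: eq_product_expectation => c; rewrite (bigD1 s) //= /sole_replica /h eqxx.
  rewrite -mulnb natrM; congr (_ * _).
  rewrite (eq_bigr (fun t => if t \in S then (~~ caches c t j)%:R else 1)); last first.
    by move=> t /negbTE ->.
  rewrite -big_mkcondr /= indicator_forall_prod.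
  by apply: eq_bigl => t; rewrite !inE.
rewrite /placement_expectation product_expectation_prod (bigD1 s) //=.
apply: ler_pM.
- by rewrite invr_ge0.
- by rewrite exprn_ge0.
- have : \sum_x cache_weight R x * h s x =
      \sum_(f : {ffun 'I_M -> 'I_K})
        cache_weight R f * (1 - (~~ [exists i, f i == j])%:R).
    apply: eq_bigr => f _; rewrite /h eqxx; congr (_ * _).
    by case: [exists _, _]; rewrite ?subrr ?subr0.
  move=> ->; under eq_bigr do rewrite mulrBr mulr1.
  rewrite sumrB sum_cache_weight // cache_weight_avoid.
  have [K10 K11] : 0 <= 1 - K%:R^-1 :> R /\ 1 - K%:R^-1 <= 1 :> R.
    by rewrite subr_ge0 gerBl invr_ge0 ler0n invf_le1 ?ltr0n // ler1n K0.
  rewrite lerBrDr addrC -lerBrDr -[leRHS]expr1.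
  exact: ler_wiXn2l.
- rewrite -prodr_const [leLHS](bigD1 s) //=.
  rewrite [leLHS](_ : _ = avoid_prob R K M *
      \prod_(t | t != s) (if t \in S then avoid_prob R K M else 1)); last first.
    by congr (_ * _); rewrite -big_mkcondr; apply: eq_bigl => t; rewrite andbC.
  rewrite [leRHS](_ : _ = 
      \prod_(t | t != s) (if t \in S then avoid_prob R K M else 1)); last first.
    apply: eq_bigr => t ts; rewrite /h (negbTE ts); case: ifP => _.
      exact: cache_weight_avoid.
    by under eq_bigr do rewrite mulr1; apply: sum_cache_weight.
  rewrite ler_piMl // prodr_ge0 // => t _; case: ifP => //.
Qed.

(** The radius [2 * b] bounds all distances within a square of side [b]. *)
Definition covered (m K M : nat) (b : nat) (c : placement m K M) : bool :=
  [forall u, forall j, exists v, caches c v j && (torus_dist u v <= 2 * b)%N].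

(** Union bound over pairs of an origin and a file: an uncovered pair forces the whole square of
    side [b] around the origin to miss the file. *)
Lemma placement_covered (R : realType) (m K M b : nat) : (0 < K)%N ->
  (0 < b <= m)%N ->
  placement_expectation (fun c : placement m K M => (~~ covered b c)%:R) <=
  (m ^ 2 * K)%:R * avoid_prob R K M ^+ (b ^ 2).
Proof.
move=> K0 bm; apply: (@le_trans _ _ (placement_expectation
    (fun c : placement m K M => \sum_(x : server m * 'I_K)
       ([forall s in torus_square_around x.1 b, ~~ caches c s x.2])%:R))).
  apply: le_product_expectation => [f|c]; first exact: cache_weight_ge0.
  case: (boolP (covered b c)) => [_|]; first by rewrite sumr_ge0.
  rewrite negb_forall => /existsP[u]; rewrite negb_forall => /existsP[j].
  rewrite negb_exists => /forallP far.
  suff allN : [forall s in torus_square_around u b, ~~ caches c s j].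
    by rewrite (bigD1 (u, j)) //= allN lerDl sumr_ge0.
  apply/forallP => s; apply/implyP => su; have := far s; rewrite negb_and.
  case/orP => // /negP[]; apply: torus_square_dist su.
  exact: mem_torus_square_around.
rewrite /placement_expectation product_expectation_sum.
rewrite (eq_bigr (fun=> avoid_prob R K M ^+ (b ^ 2))) => [|x _]; last first.
  rewrite -(@card_torus_square_around _ x.1); last by case/andP: bm.
  exact: placement_avoid.
by rewrite sumr_const card_prod card_prod !card_ord mulr_natl.
Qed.

Definition box_isolated (m K M g : nat) (j : 'I_K)
    (i : 'I_(m %/ (12 * g)) * 'I_(m %/ (12 * g))) (c : placement m K M) : bool :=
  [exists s in torus_box_core m g i.1 i.2,
     sole_replica c (torus_box m (12 * g) i.1 i.2) j s].

(** The positions of the sole replica are mutually exclusive, so probabilities add up over the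
    [16 * g ^ 2] servers of the core; the whole box has [144 * g ^ 2]. *)
Lemma placement_box_isolated (R : realType) (m K M g : nat) (j : 'I_K)
    (i : 'I_(m %/ (12 * g)) * 'I_(m %/ (12 * g))) : (0 < M)%N ->
  (16 * g ^ 2)%:R * (K%:R^-1 * avoid_prob R K M ^+ (144 * g ^ 2)) <=
  placement_expectation (fun c : placement m K M => (box_isolated j i c)%:R).
Proof.
move=> M0; have f1 := torus_box_fits (ltn_ord i.1).
have f2 := torus_box_fits (ltn_ord i.2).
have -> : placement_expectation (fun c : placement m K M =>
    (box_isolated j i c)%:R) =
    placement_expectation (fun c : placement m K M =>
      \sum_(s in torus_box_core m g i.1 i.2)
        (sole_replica c (torus_box m (12 * g) i.1 i.2) j s)%:R) :> R.
  apply: eq_product_expectation => c; rewrite indicator_exists_sum //.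
  move=> s s' /torus_box_core_sub sB /torus_box_core_sub s'B.
  exact: sole_replica_uniq.
rewrite /placement_expectation product_expectation_sum.
have -> : (16 * g ^ 2 = #|torus_box_core m g i.1 i.2|)%N.
  by rewrite card_torus_square; lia.
rewrite mulr_natl -sumr_const; apply: ler_sum => s /torus_box_core_sub sB.
have := placement_sole_replica R j M0 sB; rewrite card_torus_square //.
by rewrite [((12 * g) ^ 2)%N]expnMn.
Qed.

(** Disjoint boxes give independent events. If [z] is the lower bound for one box, each box fails
    with probability at most [1 - z <= expR (- z)]. *)
Lemma placement_no_isolated (R : realType) (m K M g : nat) (j : 'I_K) :
  (0 < M)%N ->
  placement_expectation (fun c : placement m K M =>
    [forall i, ~~ box_isolated (g := g) j i c]%:R) <=
  expR (- ((m %/ (12 * g)) ^ 2)%:R * ((16 * g ^ 2)%:R *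
    (K%:R^-1 * avoid_prob R K M ^+ (144 * g ^ 2)))).
Proof.
move=> M0; have K0 : (0 < K)%N by apply: leq_trans (ltn_ord j).
have w1 := sum_cache_weight R M K0.
set z := _%:R * (_ * _).
have -> : placement_expectation (fun c : placement m K M =>
    [forall i, ~~ box_isolated (g := g) j i c]%:R) =
    placement_expectation (fun c : placement m K M =>
      \prod_i (1 - (box_isolated (g := g) j i c)%:R)) :> R.
  apply: eq_product_expectation => c.
  rewrite (eq_bigr (fun i => (~~ box_isolated j i c)%:R)) => [|i _]; last first.
    by case: box_isolated; rewrite ?subrr ?subr0.
  exact: (indicator_forall_prod R predT).
rewrite /placement_expectation (@product_expectation_blocks _ _ _ _ _
    (fun i : 'I_(m %/ (12 * g)) * 'I_(m %/ (12 * g)) =>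
       torus_box m (12 * g) i.1 i.2)) //; first last.
- move=> i c d cd; congr (1 - (nat_of_bool _)%:R); apply: eq_existsb => s.
  case: (boolP (s \in torus_box_core m g i.1 i.2)) => //= /torus_box_core_sub sB.
  exact: (sole_replica_depends _ sB).
- move=> [i1 i2] [j1 j2] t /= ti /(torus_box_disjoint ti)[e1 e2].
  by congr (_, _); apply: val_inj.
apply: (@le_trans _ _ (\prod_(i : 'I_(m %/ (12 * g)) * 'I_(m %/ (12 * g))) expR (- z))).
  apply: ler_prod => i _; rewrite product_expectation_compl //.
  have isoz := placement_box_isolated R j i M0.
  apply/andP; split; last first.
    apply: le_trans (expR_ge1Dx _); rewrite lerD2l lerN2; exact: isoz.
  rewrite subr_ge0 -[leRHS](product_expectation1 (server m) w1).
  apply: le_product_expectation => [f|c]; first exact: cache_weight_ge0.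
  by rewrite lern1 leq_b1.
by rewrite prodr_const card_prod card_ord -expRM_natl mulnn mulrN mulNr.
Qed.

(** * Loads given the placement *)

Local Arguments nearest_replica_kernel : simpl never.

Lemma nearest_replica_kernel_ge0 (R : realType) (m K M : nat)
    (c : placement m K M) (u : server m) (j : 'I_K) (o : option (server m)) :
  0 <= nearest_replica_kernel R c u j o.
Proof.
by case: o => [s|] /=; rewrite /nearest_replica_kernel //; case: ifP;
  rewrite ?invr_ge0.
Qed.

Lemma nearest_replica_kernel_le1 (R : realType) (m K M : nat)
    (c : placement m K M) (u : server m) (j : 'I_K) (s : server m) :
  nearest_replica_kernel R c u j (Some s) <= (s \in nearest_replicas c u j)%:R.
Proof.
rewrite /nearest_replica_kernel; case: ifP => // sN.
have N0 : (0 < #|nearest_replicas c u j|)%N by apply/card_gt0P; exists s.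
by rewrite invf_le1 ?ltr0n // ler1n.
Qed.

Lemma sum_nearest_replica_kernel (R : realType) (m K M : nat)
    (c : placement m K M) (u : server m) (j : 'I_K) :
  \sum_o nearest_replica_kernel R c u j o = 1.
Proof.
rewrite /nearest_replica_kernel; set N := nearest_replicas c u j.
rewrite (bigD1 None) //= (reindex_omap Some id) /=; last by case.
under eq_bigl do rewrite eqxx.
rewrite -big_mkcond /= sumr_const -[X in _ + X]mulr_natr.
have [->|N0] := eqVneq #|N| 0%N; first by rewrite mulr0 addr0.
by rewrite add0r mulVf ?pnatr_eq0.
Qed.

(** The conditional law of requests and assignment given the placement. *)
Definition service_pmf (R : realType) (m K M : nat) (c : placement m K M)
    (x : requests m K * assignment m) : R :=
  requests_pmf (uniform_popularity R (K := K)) x.1 * assignment_pmf R c x.1 x.2.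

Lemma service_pmf_ge0 (R : realType) (m K M : nat) (c : placement m K M)
    (x : requests m K * assignment m) : 0 <= service_pmf R c x.
Proof.
rewrite mulr_ge0 ?prodr_ge0 // => t _; last exact: nearest_replica_kernel_ge0.
by rewrite mulr_ge0 ?invr_ge0.
Qed.

Lemma strategy1_probE (R : realType) (m K M : nat) (E : pred (outcome m K M)) :
  strategy1_prob (uniform_popularity R (K := K)) E =
  placement_expectation (fun c : placement m K M =>
    \sum_(x | E (c, x.1, x.2)) service_pmf R c x).
Proof.
rewrite /strategy1_prob /placement_expectation /product_expectation.
transitivity (\sum_(c : placement m K M) \sum_(x : requests m K * assignment m)
    if E (c, x.1, x.2) then strategy1_pmf (uniform_popularity R (K := K)) (c, x.1, x.2)
    else 0).
  rewrite pair_bigA big_mkcond /=.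
  rewrite (reindex (fun p : placement m K M * (requests m K * assignment m) =>
    (p.1, p.2.1, p.2.2))) //=.
  by exists (fun w => (w.1.1, (w.1.2, w.2))) => [[c [r a]]|[[c r] a]].
apply: eq_bigr => c _; rewrite -big_mkcond mulr_sumr; apply: eq_bigr => x _.
by rewrite /strategy1_pmf /service_pmf mulrA.
Qed.

(** The chance that one request is assigned to [s], that is, the success probability of its binomial
    load given [c]. *)
Definition hit_prob (R : realType) (m K M : nat) (c : placement m K M)
    (s : server m) : R :=
  \sum_(x : server m * 'I_K) (m ^ 2)%:R^-1 * K%:R^-1 *
    nearest_replica_kernel R c x.1 x.2 (Some s).

(** Given the placement, requests are served independently, so this is the moment generating
    function of a binomial law. *)
Lemma load_mgf (R : realType) (m K M : nat) (c : placement m K M)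
    (s : server m) (y : R) : (0 < K)%N ->
  \sum_x service_pmf R c x * expR (y * (load (c, x.1, x.2) s)%:R) =
  (1 + hit_prob R c s * (expR y - 1)) ^+ (m ^ 2).
Proof.
move=> K0; have m0 : (0 < m)%N by apply: leq_trans (ltn_ord s.1).
rewrite -(pair_bigA _ (fun r a =>
  service_pmf R c (r, a) * expR (y * (load (c, r, a) s)%:R))) /=.
(* The load counts the requests assigned to [s], so its exponential is a product over requests; [h]
   is the contribution of one. *)
pose h (x : server m * 'I_K) (o : option (server m)) : R :=
  nearest_replica_kernel R c x.1 x.2 o * (if o == Some s then expR y else 1).
have expE (r : requests m K) (a : assignment m) :
    service_pmf R c (r, a) * expR (y * (load (c, r, a) s)%:R) =
    requests_pmf (uniform_popularity R (K := K)) r * \prod_t h (r t) (a t).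
  rewrite /service_pmf -mulrA big_split /=; congr (_ * (_ * _)).
  rewrite -big_mkcond /= prodr_const mulrC expRM_natl; congr (_ ^+ _).
  by apply: eq_card => t; rewrite !inE.
transitivity (\sum_(r : requests m K)
    \prod_t ((m ^ 2)%:R^-1 * K%:R^-1 * \sum_o h (r t) o)).
  apply: eq_bigr => r _; under eq_bigr do rewrite expE.
  rewrite -mulr_sumr big_split /=; congr (_ * _).
  by rewrite (bigA_distr_bigA (fun t o => h (r t) o)).
rewrite -(bigA_distr_bigA (fun (t : 'I_(m ^ 2)) x =>
  (m ^ 2)%:R^-1 * K%:R^-1 * \sum_o h x o)) /= prodr_const card_ord.
congr (_ ^+ _).
transitivity (\sum_(x : server m * 'I_K) ((m ^ 2)%:R^-1 * K%:R^-1 +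
    (m ^ 2)%:R^-1 * K%:R^-1 * nearest_replica_kernel R c x.1 x.2 (Some s) *
    (expR y - 1)) : R).
  apply: eq_bigr => x _; rewrite [RHS](_ : _ = (m ^ 2)%:R^-1 * K%:R^-1 *
      (1 + nearest_replica_kernel R c x.1 x.2 (Some s) * (expR y - 1))); last by ring.
  congr (_ * _); rewrite -[X in _ = X + _](sum_nearest_replica_kernel R c x.1 x.2).
  rewrite /h; set k := nearest_replica_kernel R c x.1 x.2.
  rewrite (bigD1 (Some s)) //= [X in _ = X + _](bigD1 (Some s)) //= eqxx.
  rewrite (eq_bigr k); last first.
    by move=> o /negbTE ->; rewrite mulr1.
  by ring.
rewrite big_split /= -[X in _ + X]mulr_suml; congr (_ + _ * _).
rewrite sumr_const !card_prod !card_ord mulnn -[LHS]mulr_natr natrM -invfM mulVf //.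
by rewrite mulf_neq0 // pnatr_eq0 -lt0n ?expn_gt0 ?m0.
Qed.

Lemma hit_prob_ge0 (R : realType) (m K M : nat) (c : placement m K M)
    (s : server m) : 0 <= hit_prob R c s.
Proof.
apply: sumr_ge0 => x _; rewrite !mulr_ge0 ?invr_ge0 //.
exact: nearest_replica_kernel_ge0.
Qed.

Lemma hit_prob_le1 (R : realType) (m K M : nat) (c : placement m K M)
    (s : server m) : (0 < K)%N -> hit_prob R c s <= 1.
Proof.
move=> K0; have m0 : (0 < m)%N by apply: leq_trans (ltn_ord s.1).
apply: (@le_trans _ _ (\sum_(x : server m * 'I_K) (m ^ 2)%:R^-1 * K%:R^-1 * 1)).
  apply: ler_sum => x _; apply: ler_wpM2l; first by rewrite mulr_ge0 ?invr_ge0.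
  by apply: le_trans (nearest_replica_kernel_le1 _ _ _ _ _) _; rewrite lern1 leq_b1.
rewrite sumr_const !card_prod !card_ord mulnn mulr1 -[leLHS]mulr_natr natrM.
by rewrite -invfM mulVf // mulf_neq0 // pnatr_eq0 -lt0n ?expn_gt0 ?m0.
Qed.

(** Markov's inequality for [expR (y * load)]. The sign of [y] selects the tail; [y = 0] gives the
    bound on the total mass. *)
Lemma load_chernoff (R : realType) (m K M : nat) (c : placement m K M)
    (s : server m) (y lam : R) (E : pred (requests m K * assignment m)) :
  (0 < K)%N ->
  (forall x, E x -> y * lam <= y * (load (c, x.1, x.2) s)%:R) ->
  \sum_(x | E x) service_pmf R c x <=
  expR ((m ^ 2)%:R * hit_prob R c s * (expR y - 1) - y * lam).
Proof.
move=> K0 Elam.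
apply: (@le_trans _ _ (\sum_x service_pmf R c x *
    expR (y * (load (c, x.1, x.2) s)%:R) * expR (- (y * lam)))).
  rewrite [leLHS]big_mkcond /=; apply: ler_sum => x _.
  have pos := service_pmf_ge0 R c x.
  rewrite -mulrA -expRD; case: ifP => [/Elam h|_].
    by rewrite ler_peMr // -[leLHS]expR0 ler_expR subr_ge0.
  by rewrite mulr_ge0 // expR_ge0.
rewrite -mulr_suml load_mgf // expRD; apply: ler_wpM2r; first exact: expR_ge0.
(* Raising [1 + x <= expR x] to a power requires [1 + x] to be nonnegative, which holds because
   [hit_prob] is at most 1. *)
rewrite -mulrA expRM_natl; apply: lerXn2r; rewrite ?nnegrE ?expR_ge0 //; last first.
  exact: expR_ge1Dx.
have p0 := hit_prob_ge0 R c s; have p1 := hit_prob_le1 R c s K0.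
by have := expR_ge0 y; nra.
Qed.

(** Under coverage, [s] serves only origins in its ball of radius [2 * b], and only the at most [M]
    distinct files it caches. *)
Lemma hit_prob_covered (R : realType) (m K M b : nat) (c : placement m K M)
    (s : server m) : covered b c ->
  hit_prob R c s <= (m ^ 2)%:R^-1 * K%:R^-1 * (M * (4 * b).+1 ^ 2)%:R.
Proof.
move=> /forallP cov; rewrite /hit_prob -mulr_sumr.
apply: ler_wpM2l; first by rewrite mulr_ge0 ?invr_ge0.
apply: (@le_trans _ _ (\sum_(x : server m * 'I_K)
    ((caches c s x.2) && (torus_dist x.1 s <= 2 * b)%N)%:R)).
  apply: ler_sum => -[u j] _.
  apply: le_trans (nearest_replica_kernel_le1 _ _ _ _ _) _ => /=.
  rewrite ler_nat; case: (boolP (s \in _)) => //; rewrite inE.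
  case/andP => -> /forallP near /=; rewrite lt0b.
  have /forallP/(_ j)/existsP[v /andP[vj uv]] := cov u.
  by apply: leq_trans uv; have := near v; rewrite vj.
rewrite -natr_sum ler_nat -(pair_bigA _ (fun u j =>
  (caches c s j && (torus_dist u s <= 2 * b)%N : nat))) /=.
rewrite exchange_big /=.
rewrite (eq_bigr (fun j => if caches c s j then
    #|[set u : server m | (torus_dist u s <= 2 * b)%N]| else 0%N)) => [|j _].
  rewrite -big_mkcond /= sum_nat_const leq_mul //; last first.
    by rewrite (_ : 4 * b = 2 * (2 * b))%N ?card_torus_ball // mulnA.
  apply: (@leq_trans #|[set c s i | i : 'I_M]|).
    apply: subset_leq_card; apply/fintype.subsetP => j.
    by move=> /existsP[i /eqP <-]; apply: imset_f.
  by apply: leq_trans (leq_imset_card _ _) _; rewrite card_ord.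
case: (caches c s j) => /=; last by rewrite big1.
rewrite -sum1_card [RHS]big_mkcond /=; apply: eq_bigr => u _.
by rewrite inE; case: (_ <= _)%N.
Qed.

(** The sole replica [s] of the box serves every request for [j] coming from the square of side [g]
    with corner [s]. *)
Lemma hit_prob_isolated (R : realType) (m K M g : nat) (j : 'I_K)
    (i : 'I_(m %/ (12 * g)) * 'I_(m %/ (12 * g))) (c : placement m K M) :
  box_isolated j i c ->
  exists s : server m, (m ^ 2)%:R^-1 * K%:R^-1 * (g ^ 2)%:R <= hit_prob R c s.
Proof.
case/existsP => s /andP[score /andP[cs /forallP sole]]; exists s.
have f1 := torus_box_fits (ltn_ord i.1).
have f2 := torus_box_fits (ltn_ord i.2).
rewrite /hit_prob -mulr_sumr.
apply: ler_wpM2l; first by rewrite mulr_ge0 ?invr_ge0.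
have near u : u \in torus_square m s.1 s.2 g -> nearest_replicas c u j = [set s].
  move=> us; have uds : (torus_dist u s <= 2 * g)%N.
    apply: (torus_square_dist us).
    by move: us; rewrite !inE; lia.
  (* A rival no farther from [u] than [s] would be within [4 * g] of [s], hence in the box, where
     [s] is the only replica. *)
  have far s' : caches c s' j -> s' != s -> (torus_dist u s < torus_dist u s')%N.
    move=> cs' ns'; rewrite ltnNge; apply/negP => le_d.
    have sbox : s' \in torus_box m (12 * g) i.1 i.2.
      apply: (torus_box_core_dist (ltn_ord i.1) (ltn_ord i.2) score).
      apply: leq_trans (torus_dist_triangle _ u _) _; rewrite torus_distC; lia.
    by have := sole s'; rewrite in_setD1 ns' sbox cs'.
  apply/setP => s'; rewrite !inE; apply/andP/eqP => [[cs' /forallP/(_ s)]|->].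
    rewrite cs /=; have [//|ns'] := eqVneq s' s.
    by rewrite leqNgt far.
  split=> //; apply/forallP => s''; apply/implyP => cs''.
  by have [->//|ns''] := eqVneq s'' s; apply/ltnW/far.
rewrite -(pair_bigA _ (fun u k => nearest_replica_kernel R c u k (Some s))) /=.
(* As [s] is in the core, this square fits in the fundamental domain. *)
rewrite -(@card_torus_square m s.1 s.2 g); first last.
- by move: score; rewrite !inE; lia.
- by move: score; rewrite !inE; lia.
rewrite -sumr_const big_mkcond /=; apply: ler_sum => u _.
case: ifP => [us|_]; last first.
  by apply: sumr_ge0 => k _; apply: nearest_replica_kernel_ge0.
have ker1 : nearest_replica_kernel R c u j (Some s) = 1.
  by rewrite /nearest_replica_kernel near // set11 cards1 invr1.
rewrite (bigD1 j) // ker1 lerDl sumr_ge0 // => k _.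
exact: nearest_replica_kernel_ge0.
Qed.

(** * Tail bounds for the maximum load *)

Lemma expRN1_le (R : realType) : expR (- 1) - 1 <= - 2^-1 :> R.
Proof.
suff : expR (- 1) <= 2^-1 :> R by lra.
by rewrite expRN lef_pV2 ?posrE ?expR_gt0 //; have := expR_ge1Dx (1 : R); lra.
Qed.

(** Union bound over the servers and Chernoff at [y = 1], with [expR 1 - 1] rounded up to
    [expR 1]. *)
Lemma service_overload (R : realType) (m K M b : nat) (c : placement m K M)
    (hi : R) : (0 < K)%N -> (0 < m)%N -> covered b c ->
  \sum_(x | hi < (max_load (c, x.1, x.2))%:R) service_pmf R c x <=
  (m ^ 2)%:R * expR ((M * (4 * b).+1 ^ 2)%:R / K%:R * expR 1 - hi).
Proof.
move=> K0 m0 cov.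
apply: (@le_trans _ _ (\sum_(s : server m)
    \sum_(x | hi < (load (c, x.1, x.2) s)%:R) service_pmf R c x)).
  rewrite (exchange_big_dep predT) //= big_mkcond /=; apply: ler_sum => x _.
  case: ifP => [hix|_]; last by apply: sumr_ge0 => s _; apply: service_pmf_ge0.
  have server0 : (0 < #|server m|)%N by rewrite card_prod card_ord muln_gt0 m0.
  have [s maxs] := bigop.eq_bigmax (load (c, x.1, x.2)) server0.
  rewrite /max_load maxs in hix.
  rewrite (bigD1 s) //= lerDl; apply: sumr_ge0 => ? _; exact: service_pmf_ge0.
rewrite (_ : (m ^ 2)%:R = #|server m|%:R); last by rewrite card_prod card_ord mulnn.
rewrite mulr_natl -sumr_const; apply: ler_sum => s _.
apply: le_trans (load_chernoff (y := 1) (lam := hi) (s := s) K0 _) _.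
  by move=> x /ltW; rewrite !mul1r.
rewrite ler_expR mul1r lerD2r.
have e1 := expR_ge1Dx (1 : R); have e0 := expR_ge0 (1 : R).
apply: (@le_trans _ _ ((M * (4 * b).+1 ^ 2)%:R / K%:R * (expR 1 - 1))); last first.
  by apply: ler_wpM2l; [rewrite mulr_ge0 ?invr_ge0|lra].
apply: ler_wpM2r; first by lra.
have N0 : (m ^ 2)%:R != 0 :> R by rewrite pnatr_eq0 -lt0n expn_gt0 m0.
apply: le_trans (ler_wpM2l (ler0n _ _) (hit_prob_covered R s cov)) _.
by rewrite !mulrA mulfV // mul1r mulrC.
Qed.

(** The maximum is at least the load of the isolated server. Chernoff at [y = -1] applies to it, and
    [expR (- 1) - 1 <= - 1 / 2] yields the divisor 2. *)
Lemma service_underload (R : realType) (m K M g : nat) (j : 'I_K)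
    (i : 'I_(m %/ (12 * g)) * 'I_(m %/ (12 * g))) (c : placement m K M) (lo : R) :
  (0 < m)%N -> box_isolated j i c ->
  \sum_(x | (max_load (c, x.1, x.2))%:R < lo) service_pmf R c x <=
  expR (lo - (g ^ 2)%:R / K%:R / 2).
Proof.
move=> m0 /(hit_prob_isolated R)[s hits].
have K0 : (0 < K)%N by apply: leq_trans (ltn_ord j).
apply: le_trans (load_chernoff (y := - 1) (lam := lo) (s := s) K0 _) _.
  move=> x maxx; rewrite ler_nM2l ?ltrN10 //; apply: le_trans (ltW maxx).
  by rewrite ler_nat; apply: leq_bigmax.
rewrite ler_expR mulN1r opprK addrC lerD2l.
have N0 : (m ^ 2)%:R != 0 :> R by rewrite pnatr_eq0 -lt0n expn_gt0 m0.
have := ler_wpM2l (ler0n R (m ^ 2)) hits; rewrite !mulrA mulfV // mul1r.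
rewrite mulrC; set p := _ * hit_prob _ _ _; set q := (g ^ 2)%:R / K%:R => qp.
have q0 : 0 <= q by rewrite mulr_ge0 ?invr_ge0.
by have := expRN1_le R; nra.
Qed.

Lemma service_total (R : realType) (m K M : nat) (c : placement m K M)
    (E : pred (requests m K * assignment m)) : (0 < K)%N -> (0 < m)%N ->
  \sum_(x | E x) service_pmf R c x <= 1.
Proof.
case: m c E => // m c E K0 _.
have := @load_chernoff R _ _ _ c (ord0, ord0) 0 0 E K0.
by rewrite expR0 subrr !mulr0 subr0 expR0; apply=> x _; rewrite !mul0r.
Qed.

(** All four terms are written as expectations over the placement and compared pointwise: a bad
    placement is charged to its indicator, a good one to the two Chernoff bounds. *)
Lemma max_load_tail (R : realType) (m K M b g : nat) (lo hi : R) :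
  (0 < K)%N -> (0 < M)%N -> (0 < b <= m)%N ->
  strategy1_prob (uniform_popularity R (K := K))
    (fun w : outcome m K M => ~~ (lo <= (max_load w)%:R <= hi)) <=
  (m ^ 2 * K)%:R * avoid_prob R K M ^+ (b ^ 2) +
  expR (- ((m %/ (12 * g)) ^ 2)%:R * ((16 * g ^ 2)%:R *
    (K%:R^-1 * avoid_prob R K M ^+ (144 * g ^ 2)))) +
  ((m ^ 2)%:R * expR ((M * (4 * b).+1 ^ 2)%:R / K%:R * expR 1 - hi) +
   expR (lo - (g ^ 2)%:R / K%:R / 2)).
Proof.
move=> K0 M0 bm; have m0 : (0 < m)%N by case/andP: bm; apply: leq_trans.
pose j : 'I_K := Ordinal K0.
rewrite strategy1_probE.
set U := _ * expR (_ - hi); set L := expR (lo - _).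
have U0 : 0 <= U by rewrite mulr_ge0 ?expR_ge0.
have L0 : 0 <= L by rewrite expR_ge0.
apply: le_trans (lerD (lerD (placement_covered R M K0 bm)
  (placement_no_isolated R m g j M0)) (lexx (U + L))).
rewrite /placement_expectation.
rewrite -[X in _ <= _ + X](product_expectation_cst (server m) _
  (sum_cache_weight R M K0)).
rewrite -!product_expectationD; apply: le_product_expectation => [f|c].
  exact: cache_weight_ge0.
have total1 := @service_total R m K M c
  (fun x => ~~ (lo <= (max_load (c, x.1, x.2))%:R <= hi)) K0 m0.
case: (boolP (covered b c)) => [cov|_]; last first.
  have : 0 <= [forall i, ~~ box_isolated (g := g) j i c]%:R :> R by [].
  by move: total1 => /=; lra.
case: (boolP [forall i, _]) => [_|]; first by move: total1 => /=; lra.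
rewrite negb_forall => /existsP[i]; rewrite negbK => iso.
rewrite /= !add0r; apply: le_trans (lerD (service_overload hi K0 m0 cov)
  (service_underload lo m0 iso)).
rewrite big_mkcond [X in _ <= X + _]big_mkcond [X in _ <= _ + X]big_mkcond.
rewrite -big_split /=; apply: ler_sum => x _.
have := service_pmf_ge0 R c x; rewrite negb_and -!ltNge.
by case: (_ < lo); case: (hi < _) => /=; lra.
Qed.

(** * Asymptotics *)

(** The quadratic term [(a * x) ^ 2 / 2] of the exponential already dominates [C * x] beyond this
    threshold. *)
Lemma linear_le_expR (R : realType) (a C x : R) : 0 < a -> 0 <= x ->
  2 * C / a ^+ 2 <= x -> C * x <= expR (a * x).
Proof.
move=> a0 x0 Cx; have ax0 : 0 <= a * x by rewrite mulr_ge0 // ltW.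
apply: le_trans (expR_ge1Dxn 1 ax0).
rewrite ler_pdivrMr ?exprn_gt0 // in Cx.
have := ler_wpM2r x0 Cx; rewrite exprMn (_ : (2`!)%:R = 2 :> R) //.
by lra.
Qed.

Lemma avoid_prob_le_expR (R : realType) (K M : nat) : (0 < K)%N -> (0 < M)%N ->
  avoid_prob R K M <= expR (- K%:R^-1).
Proof.
move=> K0 M0; apply: le_trans (expR_ge1Dx _); rewrite -[leRHS]expr1.
apply: ler_wiXn2l => //; first by rewrite subr_ge0 invf_le1 ?ltr0n // ler1n.
Qed.

(** For [K >= 2], the inverse of [1 - 1 / K] is [1 + 1 / (K - 1) <= 1 + 2 / K <= expR (2 / K)]. *)
Lemma avoid_prob_ge_expR (R : realType) (K M : nat) : (1 < K)%N ->
  expR (- (2 * M%:R / K%:R)) <= avoid_prob R K M.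
Proof.
move=> K1; have k2 : 2 <= K%:R :> R by rewrite ler_nat.
have -> : - (2 * M%:R / K%:R) = M%:R * (- (2 / K%:R)) :> R by rewrite -!mulrA; ring.
rewrite expRM_natl; apply: lerXn2r; rewrite ?nnegrE ?expR_ge0 //.
  by rewrite subr_ge0 invf_le1 //; lra.
rewrite expRN -[leRHS]invrK lef_pV2 ?posrE ?invr_gt0 ?expR_gt0 //; last first.
  by rewrite subr_gt0 invf_lt1 //; lra.
apply: le_trans (expR_ge1Dx _).
have k0 : K%:R != 0 :> R by rewrite gt_eqF //; lra.
have k1 : K%:R - 1 != 0 :> R by rewrite gt_eqF //; lra.
rewrite (_ : (1 - K%:R^-1)^-1 = 1 + (K%:R - 1)^-1); last by field; rewrite k0 k1.
rewrite lerD2l ler_pdivlMr; last lra.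
by rewrite mulrC ler_pdivrMr; lra.
Qed.

(** Here and below [l] is the logarithm of [n = m ^ 2]. The union bound costs at most
    [n ^ 2 = expR (2 * l)], and a square is missed with probability at most [expR (- (4 * l))]. *)
Lemma uncovered_bound (R : realType) (m K M b : nat) (l : R) :
  (0 < K)%N -> (0 < M)%N -> (m ^ 2)%:R = expR l -> K%:R <= expR l ->
  4 * (K%:R * l) <= (b ^ 2)%:R ->
  (m ^ 2 * K)%:R * avoid_prob R K M ^+ (b ^ 2) <= expR (- (2 * l)).
Proof.
move=> K0 M0 Nl Kl bK; have k0 : 0 < K%:R :> R by rewrite ltr0n.
have /andP[q0 _] := avoid_prob_itv R M K0.
rewrite natrM Nl; apply: (@le_trans _ _ (expR l * expR l * expR (- (4 * l)))).
  apply: ler_pM; [by rewrite mulr_ge0 ?expR_ge0 | exact: exprn_ge0 | |].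
    by rewrite ler_pM2l ?expR_gt0.
  apply: (@le_trans _ _ (expR (- K%:R^-1) ^+ (b ^ 2))).
    by apply: lerXn2r; rewrite ?nnegrE ?expR_ge0 ?avoid_prob_le_expR.
  rewrite -expRM_natl ler_expR mulrN lerN2 ler_pdivlMr //.
  by apply: le_trans bK; lra.
by rewrite -!expRD ler_expR; lra.
Qed.

(** The library has size about [n ^ a], and keeping a box free of further replicas costs [n ^ d];
    the exponent is therefore at least [n ^ (1 - a - d) / 72]. *)
Lemma not_isolated_bound (R : realType) (m K M g : nat) (l a d : R) :
  (1 < K)%N -> (0 < g)%N -> (24 * g <= m)%N -> (m ^ 2)%:R = expR l ->
  288 * M%:R * (g ^ 2)%:R <= d * l * K%:R ->
  K%:R <= 2 * expR (a * l) -> 72 * l <= expR ((1 - a - d) * l) ->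
  expR (- ((m %/ (12 * g)) ^ 2)%:R * ((16 * g ^ 2)%:R *
    (K%:R^-1 * avoid_prob R K M ^+ (144 * g ^ 2)))) <= expR (- l).
Proof.
move=> K1 g0 gm Nl gd Ka lbig; have K0 : (0 < K)%N by apply: ltnW.
have k0 : 0 < K%:R :> R by rewrite ltr0n.
rewrite ler_expR mulNr lerN2 [leRHS]mulrA.
(* Rounding down loses at most a factor 2 in the number of boxes per side, and
   [24 ^ 2 = 36 * 16]. *)
have boxes : (m ^ 2 <= 36 * ((m %/ (12 * g)) ^ 2 * (16 * g ^ 2)))%N.
  set Q := (m %/ (12 * g))%N.
  have Qm : (m <= Q * (24 * g))%N.
    have := divn_eq m (12 * g); have := ltn_pmod m (_ : 0 < 12 * g)%N.
    by rewrite -/Q => /(_ ltac:(lia)); nia.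
  apply: leq_trans (_ : (Q * (24 * g)) ^ 2 <= _)%N; first by rewrite leq_sqr.
  by rewrite !expnMn; lia.
have avoid : expR (- (d * l)) <= avoid_prob R K M ^+ (144 * g ^ 2).
  apply: (@le_trans _ _ (expR (- (2 * M%:R / K%:R)) ^+ (144 * g ^ 2))); last first.
    have /andP[q0 _] := avoid_prob_itv R M K0.
    by apply: lerXn2r; rewrite ?nnegrE ?expR_ge0 ?avoid_prob_ge_expR.
  rewrite -expRM_natl ler_expR mulrN lerN2 mulrA ler_pdivrMr //.
  by rewrite natrM; lra.
apply: (@le_trans _ _ (expR l / 36 * (K%:R^-1 * expR (- (d * l))))); last first.
  apply: ler_pM.
  - by rewrite mulr_ge0 ?expR_ge0.
  - by rewrite mulr_ge0 ?expR_ge0 ?invr_ge0 ?ltW.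
  - by move: boxes; rewrite -(ler_nat R) -Nl !natrM; lra.
  - by apply: ler_wpM2l => //; rewrite invr_ge0 ltW.
apply: (@le_trans _ _ (expR ((1 - a - d) * l) / 72)).
  by rewrite ler_pdivlMr // mulrC.
rewrite [leRHS](_ : _ = expR (l - d * l) / 36 / K%:R); last first.
  by rewrite expRD; ring.
rewrite ler_pdivlMr // (_ : (1 - a - d) * l = (l - d * l) + - (a * l)); last by ring.
rewrite [X in X / 72]expRD expRN; set e := expR (l - d * l).
have e0 : 0 <= e by rewrite expR_ge0.
have := ler_wpM2l (mulr_ge0 e0 (ltW (_ : 0 < (expR (a * l))^-1))) Ka.
rewrite invr_gt0 expR_gt0 => /(_ isT).
have ea : expR (a * l) != 0 by rewrite gt_eqF ?expR_gt0.
rewrite (_ : e / _ * (2 * _) = 2 * e); last by field.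
by lra.
Qed.

(** The constant is [225 = 25 * 9], from [(4 * b + 1) ^ 2 <= 25 * b ^ 2]. Of the extra [2 * l], one
    half pays for the union bound over [n] servers. *)
Lemma overload_bound (R : realType) (m K M b : nat) (l k2 : R) :
  (0 < K)%N -> (0 < b)%N -> 0 <= l -> (m ^ 2)%:R = expR l -> M%:R <= k2 ->
  (b ^ 2)%:R <= 9 * (K%:R * l) ->
  (m ^ 2)%:R * expR ((M * (4 * b).+1 ^ 2)%:R / K%:R * expR 1 -
    (225 * k2 * expR 1 + 2) * l) <= expR (- l).
Proof.
move=> K0 b0 l0 Nl Mk bK; have k0 : 0 < K%:R :> R by rewrite ltr0n.
rewrite Nl -expRD ler_expR.
suff : (M * (4 * b).+1 ^ 2)%:R / K%:R <= 225 * k2 * l.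
  by move=> h; have := ler_wpM2r (expR_ge0 1) h; lra.
rewrite ler_pdivrMr //.
have : ((4 * b).+1 ^ 2 <= 25 * b ^ 2)%N by nia.
rewrite -(ler_nat R) (natrM _ 25) (natrM _ M) => h.
apply: (@le_trans _ _ (k2 * (25 * (9 * (K%:R * l))))); last by lra.
by apply: ler_pM => //; lra.
Qed.

(** From [sqrt x < g + 1 <= 2 * g]. *)
Lemma truncn_sqrt_sqr (R : realType) (x : R) : 1 <= x ->
  let g := Num.truncn (Num.sqrt x) in
  [/\ (0 < g)%N, (g ^ 2)%:R <= x & x <= 4 * (g ^ 2)%:R].
Proof.
move=> x1 g; have x0 : 0 <= x by lra.
have s1 : 1 <= Num.sqrt x by rewrite -[leLHS]sqrtr1 ler_sqrt.
have s0 : 0 <= Num.sqrt x by lra.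
have sx := sqr_sqrtr x0.
have /andP[gs sg] := truncn_itv s0; rewrite -/g in gs sg.
have g0 : (0 < g)%N.
  by rewrite lt0n; apply: contraTneq sg => ->; rewrite -leNgt.
have g1 : 1 <= g%:R :> R by rewrite ler1n.
rewrite -natr1 in sg; rewrite natrX; split => //; rewrite -sx !expr2; nra.
Qed.

(** From [2 * sqrt x < b <= 2 * sqrt x + 1 <= 3 * sqrt x]. *)
Lemma truncnS_sqrt_sqr (R : realType) (x : R) : 1 <= x ->
  let b := (Num.truncn (2 * Num.sqrt x)).+1 in
  4 * x <= (b ^ 2)%:R /\ (b ^ 2)%:R <= 9 * x.
Proof.
move=> x1 b; have x0 : 0 <= x by lra.
have s1 : 1 <= Num.sqrt x by rewrite -[leLHS]sqrtr1 ler_sqrt.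
have s0 : 0 <= 2 * Num.sqrt x by lra.
have sx := sqr_sqrtr x0.
have /andP[gs sg] := truncn_itv s0.
have {gs sg} [sb bs] : 2 * Num.sqrt x < b%:R /\ b%:R <= 2 * Num.sqrt x + 1.
  by split=> //; rewrite /b -natr1 lerD2r.
rewrite natrX -sx; move: b sb bs => b sb bs.
have -> : 4 * Num.sqrt x ^+ 2 = (2 * Num.sqrt x) ^+ 2 by ring.
have -> : 9 * Num.sqrt x ^+ 2 = (3 * Num.sqrt x) ^+ 2 by ring.
by split; apply: lerXn2r; rewrite ?nnegrE //; lra.
Qed.

(** * Choice of scales and constants *)

Local Open Scope classical_set_scope.
Local Open Scope ring_scope.

(** [M n] is an integer, so a positive lower bound already forces [M n >= 1]. *)
Lemma eqTheta_cst_bounds (R : realType) (M : nat -> nat) :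
  (fun n => (M n)%:R : R) =Theta_\oo (fun=> 1 : R) ->
  exists (k : R) (n1 : nat), 1 <= k /\
    forall n, (n1 <= n)%N -> (0 < M n)%N /\ (M n)%:R <= k.
Proof.
rewrite eqThetaE qualifE => /asboolP[[k1 k2] /= /andP[k10 k20]] [n1 _ bnd].
exists (1 + k2), n1; split; first by lra.
move=> n /bnd []; rewrite normr1 !mulr1 normr_nat => lb ub; split; last lra.
by rewrite lt0n; apply: contraTneq lb => ->; rewrite -ltNge.
Qed.

Lemma strategy1_probC (R : realType) (m K M : nat) (E : pred (outcome m K M)) :
  (0 < m)%N -> (0 < K)%N ->
  strategy1_prob (@uniform_popularity R K) E =
  1 - strategy1_prob (@uniform_popularity R K) (fun w => ~~ E w).
Proof.
move=> m0 K0; rewrite -[X in X - _](strategy1_prob_total R M m0 K0).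
by rewrite /strategy1_prob [X in X - _](bigID E) /= addrK.
Qed.

(** The size [K] is within 1 of [n ^ (1 - eps)]. The factor 18 is 9 times the 2 in
    [K <= 2 * n ^ (1 - eps)]; the last hypothesis gives [K >= 2 + 1 / eta]. *)
Lemma library_size_bounds (R : realType) (K : nat) (eps eta l : R) :
  0 < eta -> 1 <= l -> `|K%:R - expR ((1 - eps) * l)| < 1 ->
  18 * l <= expR (eps * l) -> (3 + eta^-1) * l <= expR ((1 - eps) * l) ->
  [/\ (1 < K)%N, K%:R <= 2 * expR ((1 - eps) * l),
     9 * (K%:R * l) <= expR l & 1 <= eta * (K%:R * l)].
Proof.
have xE : expR ((1 - eps) * l) * expR (eps * l) = expR l.
  by rewrite -expRD; congr expR; ring.
rewrite -xE; set x := expR ((1 - eps) * l); set y := expR (eps * l) => {xE}.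
move=> eta0 l1; rewrite ltr_norml => /andP[Klo Khi] ly lK.
have x0 : 0 <= x by rewrite expR_ge0.
have etai : 0 < eta^-1 by rewrite invr_gt0.
have x3 : 3 + eta^-1 <= x.
  by apply: le_trans lK; rewrite ler_peMr // addr_ge0 // ltW.
have kr : 2 + eta^-1 <= K%:R :> R by move: Klo x3; clear; lra.
have kx : K%:R <= 2 * x by move: Khi x3 etai; clear; lra.
have l0 : 0 <= l by apply: le_trans l1.
split=> //.
- by rewrite -(ltr_nat R); move: kr etai; clear; lra.
- apply: (@le_trans _ _ (x * (18 * l))); last exact: ler_wpM2l.
  by have := ler_wpM2r l0 kx; clear; lra.
- have ek : 1 <= eta * K%:R.
    rewrite -[leLHS](mulfV (lt0r_neq0 eta0)) ler_pM2l //.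
    by move: kr; clear; lra.
  by rewrite mulrA -[leLHS]mulr1; apply: ler_pM.
Qed.

Lemma max_load_bounds (R : realType) (m K M : nat) (eps k2 eta l : R) :
  (m ^ 2)%:R = expR l -> 0 < eta -> 64 * eta <= 1 ->
  288 * (k2 * eta) <= eps / 4 -> (0 < m)%N -> (0 < M)%N -> M%:R <= k2 ->
  `|K%:R - expR ((1 - eps) * l)| < 1 -> 1 <= l ->
  18 * l <= expR (eps * l) -> (3 + eta^-1) * l <= expR ((1 - eps) * l) ->
  72 * l <= expR (3 / 4 * eps * l) -> 4 * l <= expR (eta / 32 * l) ->
  1 - expR (- (eta / 32) * l) <=
    strategy1_prob (@uniform_popularity R K)
      (fun w : outcome m K M => eta / 16 * l <= (max_load w)%:R <=
         (225 * k2 * expR 1 + 2) * l).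
Proof.
move=> Nl eta0 eta64 etaE m0 M0 Mk Kl l1 leps lK lN l4.
have [K1 kx kl9 ekl] := library_size_bounds eta0 l1 Kl leps lK.
have K0 : (0 < K)%N by apply: ltnW.
have k0 : 0 < K%:R :> R by rewrite ltr0n.
have l0 : 0 <= l by apply: le_trans l1.
have kkl : K%:R <= K%:R * l by rewrite ler_peMr // ltW.
have kl1 : 1 <= K%:R * l by apply: le_trans kkl; rewrite ler1n.
have kN : K%:R <= expR l.
  by apply: le_trans kl9; move: kkl kl1; clear; lra.
(* The lower bound on [b ^ 2] makes uncovered placements rare; the upper one gives [b <= m] and
   controls overload. *)
have [b4 b9] := truncnS_sqrt_sqr kl1; set b := (Num.truncn _).+1 in b4 b9.
have bm : (0 < b <= m)%N.
  apply/andP; split=> //; rewrite -leq_sqr -(ler_nat R) Nl.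
  exact: le_trans b9 kl9.
have [g0 gub glb] := truncn_sqrt_sqr ekl; set g := Num.truncn _ in g0 gub glb.
(* Since [24 ^ 2 = 9 * 64], this combines [64 * eta <= 1] with [9 * K * l <= n]. *)
have gm : (24 * g <= m)%N.
  rewrite -leq_sqr -(ler_nat R) Nl expnMn natrM natrX.
  apply: le_trans kl9; have kl0 := le_trans ler01 kl1.
  by have := ler_wpM2r kl0 eta64; move: gub; clear; lra.
rewrite strategy1_probC // lerD2l lerN2.
apply: le_trans (max_load_tail g (eta / 16 * l) _ K0 M0 bm) _.
have t1 : (m ^ 2 * K)%:R * avoid_prob R K M ^+ (b ^ 2) <= expR (- l).
  apply: le_trans (uncovered_bound K0 M0 Nl kN b4) _.
  by rewrite ler_expR lerN2 ler_peMl // ler1n.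
have t2 : expR (- ((m %/ (12 * g)) ^ 2)%:R * ((16 * g ^ 2)%:R *
    (K%:R^-1 * avoid_prob R K M ^+ (144 * g ^ 2)))) <= expR (- l).
  apply: (not_isolated_bound (a := 1 - eps) (d := eps / 4) K1 g0 gm Nl) => //.
    rewrite -[leLHS]mulrA; apply: (@le_trans _ _ (288 * (k2 * eta) * (K%:R * l))).
      rewrite -!mulrA; apply: ler_wpM2l; first exact: ler0n.
      by apply: ler_pM => //; apply: ler0n.
    rewrite -[leRHS]mulrA [l * _]mulrC.
    by apply: ler_wpM2r => //; apply: le_trans kl1.
  by rewrite (_ : 1 - _ - _ = 3 / 4 * eps) //; field.
have t3 := overload_bound (M := M) K0 (ltn0Sn _ : 0 < b)%N l0 Nl Mk b9.
(* The exponent contains [g ^ 2 / (2 * K) >= eta * l / 8], twice the lower threshold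
   [eta / 16 * l]. *)
have t4 : expR (eta / 16 * l - (g ^ 2)%:R / K%:R / 2) <= expR (- (eta / 16) * l).
  rewrite ler_expR; suff : eta * l / 4 <= (g ^ 2)%:R / K%:R by clear; lra.
  by rewrite ler_pdivlMr //; move: glb; clear; lra.
have t5 : expR (- l) <= expR (- (eta / 16) * l).
  rewrite ler_expR mulNr lerN2 ler_piMl //.
  by move: eta64; clear; lra.
(* Halving the rate absorbs the factor 4 coming from the four error terms. *)
have t6 : 4 * expR (- (eta / 16) * l) <= expR (- (eta / 32) * l).
  rewrite (_ : - (eta / 16) * l = - (eta / 32) * l + - (eta / 32 * l)); last first.
    by clear; field.
  rewrite expRD expRN mulrCA ler_piMr ?expR_ge0 // ler_pdivrMr ?expR_gt0 // mul1r.
  by apply: le_trans l4; rewrite ler_peMr.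
move: t4 t5 t6; set e := expR (- (eta / 16) * l) => t4 t5 t6.
apply: le_trans t6; have <- : e + e + (e + e) = 4 * e by clear; ring.
apply: (lerD (lerD _ _) (lerD _ t4)).
- exact: le_trans t1 t5.
- exact: le_trans t2 t5.
- exact: le_trans t3 t5.
Qed.

Theorem theorem1 (R : realType) (eps : R) (K M : nat -> nat)
  (eps_gt0 : 0 < eps) (eps_lt1 : eps < 1)
  (K_eq : forall n : nat, (0 < n)%N ->
     `|(K n)%:R - n%:R `^ (1 - eps)| < 1)
  (M_Theta : (fun n => (M n)%:R : R) =Theta_\oo (fun=> 1 : R)) :
  exists (c1 c2 c : R) (n0 : nat), [/\ 0 < c1, 0 < c2, 0 < c &
    forall m n : nat, n = (m ^ 2)%N -> (n0 <= n)%N ->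
      1 - n%:R `^ (- c) <=
        strategy1_prob (@uniform_popularity R (K n))
          (fun w : outcome m (K n) (M n) =>
             c1 * ln n%:R <= (max_load w)%:R <= c2 * ln n%:R)].
Proof.
have [k2 [n1 [k21 Mbnd]]] := eqTheta_cst_bounds M_Theta.
(* Chosen so that [288 * k2 * eta = eps / 4]; as [k2 >= 1] and [eps < 1], [64 * eta <= 1]
   follows. *)
pose eta := eps / 4 / 288 / k2.
have k20 : 0 < k2 by apply: lt_le_trans k21.
have eta0 : 0 < eta.
  exact: divr_gt0 (divr_gt0 (divr_gt0 eps_gt0 (ltr0Sn R 3)) (ltr0Sn R 287)) k20.
have etaE : 288 * (k2 * eta) <= eps / 4.
  rewrite le_eqVlt; apply/orP; left; apply/eqP; rewrite /eta.
  by move: (lt0r_neq0 k20); clear => k20; field.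
have eta64 : 64 * eta <= 1.
  rewrite mulrA ler_pdivrMr // mul1r; apply: le_trans k21.
  by move: eps_gt0 eps_lt1; clear; lra.
have etai : 0 < eta^-1 by rewrite invr_gt0.
pose thr (C a : R) := 2 * C / a ^+ 2.
have thr0 C a : 0 <= C -> 0 <= thr C a.
  by move=> C0; rewrite divr_ge0 ?sqr_ge0 // mulr_ge0.
(* A sum of nonnegative thresholds from [linear_le_expR], hence above each of them; the 1 ensures
   [1 <= l]. *)
pose l0 := 1 + thr 18 eps + thr (3 + eta^-1) (1 - eps) + thr 72 (3 / 4 * eps)
  + thr 4 (eta / 32).
exists (eta / 16), (225 * k2 * expR 1 + 2), (eta / 32),
  (maxn n1 (Num.truncn (expR l0)).+1).
split; [by rewrite divr_gt0 | | by rewrite divr_gt0 |].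
  apply: addr_gt0 (ltr0Sn R 1).
  exact: mulr_gt0 (mulr_gt0 (ltr0Sn R 224) k20) (expR_gt0 1).
move=> m _ -> ; rewrite geq_max => /andP[n1m n0m].
have n0 : (0 < m ^ 2)%N by apply: leq_trans n0m.
have m0 : (0 < m)%N by move: n0; rewrite expn_gt0 orbF.
have [M0 Mk] := Mbnd _ n1m.
have powE (a : R) : (m ^ 2)%:R `^ a = expR (a * ln (m ^ 2)%:R).
  by rewrite /powR pnatr_eq0 eqn0Ngt n0.
rewrite powE; have := K_eq _ n0; rewrite powE => Kl.
have Nl : (m ^ 2)%:R = expR (ln (m ^ 2)%:R) :> R by rewrite lnK // posrE ltr0n.
have {n0m} ll0 : l0 <= ln (m ^ 2)%:R.
  rewrite -ler_expR -Nl; apply: le_trans (ltW (truncnS_gt _)) _.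
  by rewrite ler_nat.
have h1 : 0 <= thr 18 eps by apply: thr0.
have h2 : 0 <= thr (3 + eta^-1) (1 - eps) by apply: thr0; rewrite addr_ge0 // ltW.
have h3 : 0 <= thr 72 (3 / 4 * eps) by apply: thr0.
have h4 : 0 <= thr 4 (eta / 32) by apply: thr0.
(* From here on [n] enters only through [l]. *)
move: (ln _) ll0 Nl Kl h1 h2 h3 h4; rewrite /l0 => l.
set t1 := thr 18 _; set t2 := thr _ (1 - _); set t3 := thr 72 _; set t4 := thr 4 _.
move=> ll0 Nl Kl h1 h2 h3 h4.
have l1 : 1 <= l by move: ll0 h1 h2 h3 h4; clear; lra.
have lpos : 0 <= l by apply: le_trans l1.
have big C a : 0 < a -> thr C a <= l -> C * l <= expR (a * l).
  by move=> a0; apply: linear_le_expR.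
apply: (max_load_bounds Nl eta0 eta64 etaE m0 M0 Mk Kl l1); apply: big.
- exact: eps_gt0.
- by rewrite -/t1; move: ll0 h1 h2 h3 h4; clear; lra.
- by rewrite subr_gt0.
- by rewrite -/t2; move: ll0 h1 h2 h3 h4; clear; lra.
- by rewrite mulr_gt0.
- by rewrite -/t3; move: ll0 h1 h2 h3 h4; clear; lra.
- by rewrite divr_gt0.
- by rewrite -/t4; move: ll0 h1 h2 h3 h4; clear; lra.
Qed.
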